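(* Let $G$ be a finite nonabelian group. The following conditions on $G$ are equivalent: (1) $G$ has a $3$-abelian partition with respect to an abelian subgroup $A$. (2) $|Z(G)|\ge 2$ and $G/Z(G)$ is isomorphic to one of the following groups: $\mathbb{Z}_2\times\mathbb{Z}_2$, $\mathbb{Z}_3\times\mathbb{Z}_3$, $\mathbb{S}_3$. In the first case, $A=Z(G)$, and in the two other cases $A=\langle Z(G),x\rangle$, where $x$ is an element of order $3$ outside of $Z(G)$.
   Context: $Z(G)$ denotes the center of $G$ and $\mathbb{S}_3$ the symmetric group on $3$ letters. A subset $X$ of a group is commuting if any two of its elements commute. Let $G$ be a nonabelian group, $A\subseteq G$ an abelian subgroup and $n\ge 2$ an integer. $G$ has an $n$-abelian partition with respect to $A$ if $G$ is the disjoint union $G=A\uplus A_1\uplus\cdots\uplus A_n$ of $A$ and $n$ commuting subsets $A_1,\dots,A_n$ of $G$ with $|A_i|>1$ for each $i$. The description of $A$ in the last sentence of the claim is part of condition (2).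
   Formalization: ''x of order 3'' is read as: xZ(G) has order 3 in G/Z(G). Also (2) for A gives (1) for the same A, but (1) gives only that some A is as described in (2), since other A can occur (e.g. A=1 in the quaternion group of order 8). *)

(* Defs.v *)
From mathcomp Require Import all_boot all_fingroup all_algebra all_solvable.

Set Implicit Arguments.
Unset Strict Implicit.
Unset Printing Implicit Defensive.

Local Open Scope group_scope.

(* [abelian B], for an arbitrary set [B], is [B \subset 'C(B)]: any two
   elements of [B] commute. *)
Definition has_abelian_partition (gT : finGroupType) (n : nat)
    (G A : {group gT}) : Prop :=
  [/\ 1 < n, A \subset G, abelian A &
      exists B : 'I_n -> {set gT},
        [/\ forall i, abelian (B i),
            forall i, 1 < #|B i|,
            forall i, [disjoint A & B i],
            forall i j, i != j -> [disjoint B i & B j] &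
            A :|: \bigcup_(i < n) B i = G]].

(* The order 3 of [x] is taken modulo the center.  With order 3 in [G] there
   would in general be no such [x]: in the semidirect product of <a> and <b>,
   both cyclic of order 9, with b a b^-1 = a^4, the quotient by the center
   <a^3, b^3> is Z_3 x Z_3 and every element of order 3 is central. *)
Definition central_quotient_condition (gT : finGroupType)
    (G A : {group gT}) : Prop :=
  1 < #|'Z(G)| /\
  (   (G / 'Z(G) \isog [set: 'Z_2 * 'Z_2] /\ A :=: 'Z(G))
   \/ ((G / 'Z(G) \isog [set: 'Z_3 * 'Z_3] \/ G / 'Z(G) \isog [set: 'S_3]) /\
       exists x : gT, [/\ x \in G, x \notin 'Z(G), #[coset 'Z(G) x] = 3 &
                         A :=: <<x |: 'Z(G)>>])).

(* Main.v *)
(* Suppose G is the union of four abelian subgroups.  Counting non-identity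
   elements, one of them, H, has index p = 2 or p = 3.  As p is prime, H and any
   element outside H generate G, so Z(G) lies in H and every other member of the
   cover meets H inside Z(G), hence has at most (p - 1)|Z(G)| elements outside H.
   Filling G \ H then forces |H : Z(G)| <= 3, and since G / Z(G) is not cyclic,
   its order is 4, 6 or 9, which determines it up to isomorphism.
   If Z(G) were trivial, G would have order 6, being nonabelian, whereas a
   3-abelian partition needs at least 1 + 2 + 2 + 2 elements.
   Conversely, the partition is pulled back from a partition of G / Z(G) into
   subsets of cyclic subgroups: the preimage of a cyclic subgroup is abelian. *)
Require Import Defs.
From mathcomp Require Import all_boot all_fingroup all_algebra all_solvable.
From mathcomp Require Import zify.

Set Implicit Arguments.
Unset Strict Implicit.
Unset Printing Implicit Defensive.

Local Open Scope group_scope.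

(** * Index bound for covers by subgroups *)

Lemma leq_card_bigcup (T I : finType) (P : pred I) (F : I -> {set T}) :
  #|\bigcup_(i | P i) F i| <= \sum_(i | P i) #|F i|.
Proof.
elim/big_rec2: _ => [|i n A _ leAn]; first by rewrite cards0.
by apply: leq_trans (leq_card_setU _ _) _; rewrite leq_add2l.
Qed.

(** If every index were at least [n = #|I|], each member would have at most [#|G| / n - 1]
    non-identity elements, so together they would reach at most [#|G| - n] of the [#|G| - 1] to be
    covered. *)
Lemma cover_small_index (gT : finGroupType) (I : finType)
    (G : {group gT}) (H : I -> {group gT}) :
    1 < #|I| -> (forall i, H i \subset G) -> G \subset \bigcup_i H i ->
  exists i, #|G : H i| < #|I|.
Proof.
move=> I_gt1 sHG covG; apply/existsP; apply: contraT => /existsPn lt_index.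
have le_card i : #|I| * #|(H i)^#| <= #|G| - #|I|.
  have := lt_index i; rewrite -leqNgt -(Lagrange (sHG i)) => leI.
  have -> : #|(H i)^#| = #|H i| - 1 by rewrite (cardsD1 1 (H i)) group1 addKn.
  by rewrite mulnBr muln1 leq_sub2r // mulnC leq_mul2l leI orbT.
have sG1 : G^# \subset \bigcup_i (H i)^#.
  apply/subsetP=> x; rewrite !inE => /andP[nt_x /(subsetP covG)].
  by case/bigcupP=> i _ Hx; apply/bigcupP; exists i; rewrite // !inE nt_x.
have := leq_trans (subset_leq_card sG1) (leq_card_bigcup _ _).
have : \sum_i #|I| * #|(H i)^#| <= \sum_(i : I) (#|G| - #|I|).
  by apply: leq_sum.
rewrite -big_distrr sum_nat_const /= leq_pmul2l ?(ltnW I_gt1) // => le_sum le_card1.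
have /card_gt0P[i _] : 0 < #|I| by apply: ltnW.
(* This makes the truncated subtraction [#|G| - #|I|] a genuine one. *)
have leIG : #|I| <= #|G|.
  apply: leq_trans (dvdn_leq (cardG_gt0 G) (dvdn_indexg G (H i))).
  by rewrite leqNgt.
have oG1 : #|G| = #|G^#|.+1 by rewrite (cardsD1 1 G) group1.
have := leq_trans le_card1 le_sum; rewrite oG1 in leIG *.
by move: I_gt1 leIG; move: #|I| #|G^#| => n m; lia.
Qed.

(** * Abelian subgroups of prime index *)

Section PrimeIndex.

Variables (gT : finGroupType) (G : {group gT}).
Hypothesis nabG : ~~ abelian G.

Lemma prime_index_gen (H K : {group gT}) :
    H \subset G -> K \subset G -> prime #|G : H| -> ~~ (K \subset H) ->
  H <*> K = G.
Proof.
move=> sHG sKG prG nsKH.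
have /maxgroupP[_ maxH] := p_index_maximal sHG prG.
apply/eqP; rewrite eqEsubset join_subG sHG sKG /=; apply: contraR nsKH => nsG.
have <- : H <*> K = H; last exact: joing_subr.
apply: (maxH (H <*> K)%G); rewrite ?joing_subl //=.
by rewrite properE join_subG sHG sKG.
Qed.

Lemma center_sub_prime_index (H : {group gT}) :
  H \subset G -> abelian H -> prime #|G : H| -> 'Z(G) \subset H.
Proof.
move=> sHG abH prG; apply: contraR nabG => nsZH.
rewrite -(prime_index_gen sHG (center_sub G) prG nsZH) abelianY abH center_abelian.
by rewrite centsC (subset_trans sHG) // centsC subsetIr.
Qed.

(** If [K] is not inside [H], then [K :&: H] centralizes both [H] and [K], which generate [G], so it
    is central. Moreover [K] meets at most [#|G : H|] right cosets of [H], one of which is [H]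
    itself, each in [#|K :&: H|] elements. *)
Lemma cardD_prime_index (H K : {group gT}) :
    H \subset G -> abelian H -> prime #|G : H| -> K \subset G -> abelian K ->
  #|K :\: H| <= (#|G : H| - 1) * #|'Z(G)|.
Proof.
move=> sHG abH prG sKG abK.
have [sKH|nsKH] := boolP (K \subset H).
  by rewrite (eqP (_ : K :\: H == set0)) ?cards0 ?setD_eq0.
have sIZ : K :&: H \subset 'Z(G).
  rewrite subsetI (subset_trans (subsetIl _ _) sKG).
  rewrite -[in 'C(_)](prime_index_gen sHG sKG prG nsKH) centY subsetI.
  by rewrite (subset_trans (subsetIr _ _) abH) (subset_trans (subsetIl _ _) abK).
rewrite cardsD -(Lagrange (subsetIl K H)) -[X in _ * _ - X]muln1 -mulnBr mulnC.
apply: leq_mul; last exact: subset_leq_card.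
by rewrite indexgI leq_sub2r // subset_leq_card // imsetS.
Qed.

(** With [p = #|G : H i|] and [k = #|H i : 'Z(G)|], the set [G :\: H i] has [(p - 1) * #|'Z(G)| * k]
    elements, and each of the other [#|I| - 1] members supplies at most [(p - 1) * #|'Z(G)|] of
    them. *)
Lemma index_center_prime_index (I : finType) (H : I -> {group gT}) (i : I) :
    (forall j, H j \subset G) -> (forall j, abelian (H j)) ->
    G \subset \bigcup_j H j -> prime #|G : H i| ->
  #|H i : 'Z(G)| < #|I|.
Proof.
move=> sHG abH covG prG.
have sD : G :\: H i \subset \bigcup_(j in predC1 i) (H j :\: H i).
  apply/subsetP=> x /setDP[/(subsetP covG)/bigcupP[j _ Hjx] H'x].
  apply/bigcupP; exists j; rewrite !inE ?H'x //.
  by apply: contraNneq H'x => <-.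
have := leq_trans (subset_leq_card sD) (leq_card_bigcup _ _).
have : \sum_(j in predC1 i) #|H j :\: H i|
         <= \sum_(j in predC1 i) (#|G : H i| - 1) * #|'Z(G)|.
  by apply: leq_sum => j _; apply: cardD_prime_index.
rewrite sum_nat_const cardC1 => leS leG; have:= leq_trans leG leS.
rewrite cardsD (setIidPr (sHG i)) -(Lagrange (sHG i)).
have sZH := center_sub_prime_index (sHG i) (abH i) prG.
rewrite -(Lagrange sZH).
have := prime_gt1 prG.
have := cardG_gt0 'Z(G); have : 0 < #|I| by apply/card_gt0P; exists i.
set z := #|'Z(G)|; set p := #|G : H i|; set k := #|_ : _|; set n := #|I|.
move=> n0 z0 p1 le.
have : (p - 1) * z * k <= (p - 1) * z * n.-1 by nia.
rewrite leq_pmul2l; nia.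
Qed.

End PrimeIndex.

(** * Recognizing noncyclic groups of order [p ^ 2] and 6 *)

Lemma p2group_abelem (gT : finGroupType) (p : nat) (G : {group gT}) :
  prime p -> #|G| = (p ^ 2)%N -> ~~ cyclic G -> p.-abelem G.
Proof.
move=> p_pr oG ncG; rewrite abelemE // (card_p2group_abelian p_pr oG) /=.
apply/exponentP=> x Gx; apply/eqP; rewrite -order_dvdn.
have := order_dvdG Gx; rewrite oG => /(dvdn_pfactor _ _ p_pr)[k le_k2 ox].
rewrite ox -[X in _ %| X]expn1 dvdn_exp2l // -ltnS ltn_neqAle le_k2 andbT.
apply: contraNneq ncG => k2; apply/cyclicP; exists x; apply/eqP.
by rewrite eq_sym eqEcard cycle_subG Gx oG -k2 -ox /=.
Qed.

Lemma Zp2_abelem (p : nat) : prime p -> p.-abelem [set: 'Z_p * 'Z_p].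
Proof.
move=> p_pr; have p_gt1 := prime_gt1 p_pr.
rewrite abelemE //; apply/andP; split.
  by apply/centsP=> -[a b] _ [c d] _; congr (_, _); apply: Zp_mulgC.
apply/exponentP=> x _.
have XpZ (a : 'Z_p) : a ^+ p = 1.
  (* This relies on [p > 1]: for smaller [p] the type ['Z_p] has two elements. *)
  have oT : #|[set: 'Z_p]| = p by rewrite cardsT card_ord Zp_cast.
  by apply/eqP; rewrite -order_dvdn -[X in _ %| X]oT order_dvdG ?inE.
have expP n : x ^+ n = (x.1 ^+ n, x.2 ^+ n).
  by elim: n => // n IHn; rewrite !expgS IHn.
by rewrite expP !XpZ.
Qed.

Lemma isog_Zp2 (gT : finGroupType) (p : nat) (G : {group gT}) :
  prime p -> (G \isog [set: 'Z_p * 'Z_p]) = p.-abelem G && (#|G| == p ^ 2)%N.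
Proof.
move=> p_pr; have p_gt1 := prime_gt1 p_pr.
have oZ : #|[set: 'Z_p * 'Z_p]| = (p ^ 2)%N.
  by rewrite cardsT card_prod !card_ord !Zp_cast // mulnn.
by rewrite isog_sym (isog_abelem_card G (Zp2_abelem p_pr)) oZ.
Qed.

(** An involution [x] and its conjugate by an element [z] of order 3 generate a dihedral group,
    which turns out to be all of [G]. They are distinct, as otherwise [x * z] would have order 6. *)
Lemma isog_D6 (gT : finGroupType) (G : {group gT}) :
  #|G| = 6 -> ~~ cyclic G -> G \isog [set: 'D_6].
Proof.
move=> oG ncG.
have [x Gx ox] : {x | x \in G & #[x] = 2} by apply: Cauchy; rewrite ?oG.
have [z Gz oz] : {z | z \in G & #[z] = 3} by apply: Cauchy; rewrite ?oG.
have neq_x : x != x ^ z.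
  apply: contraNneq ncG => xz; apply/cyclicP; exists (x * z); apply/eqP.
  have cxz : commute x z by apply/commgP; rewrite /commg -xz mulVg.
  rewrite eq_sym eqEcard cycle_subG groupM //= -orderE orderM // ox oz //.
  by rewrite oG.
have oxz : #[x ^ z] = 2 by rewrite orderJ.
have := involutions_gen_dihedral ox oxz neq_x => /=.
set K := <<_>>; suff -> : K = G by rewrite oG.
have sKG : K \subset G.
  by rewrite gen_subG; apply/subsetP=> t /set2P[]->; rewrite ?groupJ.
apply/eqP; rewrite eqEcard sKG oG /=.
(* The order of [K] divides 6, is even, and exceeds 2 because [K] contains 1 besides the two
   involutions. *)
have := cardSg sKG; rewrite oG => dv6.
have : 2 %| #|K|.
  by rewrite -ox order_dvdG // mem_gen // !inE eqxx.
have : #|[set x; x ^ z]| < #|K|.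
  rewrite proper_card // properE subset_gen /=.
  apply/subsetPn; exists 1; first exact: group1.
  by rewrite !inE ![1 == _]eq_sym -!order_eq1 oxz ox.
rewrite cards2 neq_x /=; have := dvdn_leq (isT : 0 < 6) dv6; move: dv6.
by case: #|K| => [|[|[|[|[|[|[|k]]]]]]].
Qed.

(** Both groups are isomorphic to ['D_6]; two transpositions sharing the point [ord0] do not
    commute, so ['S_3] is not cyclic. *)
Lemma isog_S3 (gT : finGroupType) (G : {group gT}) :
  #|G| = 6 -> ~~ cyclic G -> G \isog [set: 'S_3].
Proof.
move=> oG ncG; apply: isog_trans (isog_D6 oG ncG) _.
rewrite isog_sym isog_D6 ?cardsT ?card_Sn //.
apply/negP=> /cyclic_abelian/centsP/(_ (tperm ord0 (inord 1)) (in_setT _)).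
move=> /(_ (tperm ord0 (inord 2)) (in_setT _)) /permP/(_ ord0).
rewrite !permM !tpermL !tpermD //; last 4 first.
all: try by rewrite -val_eqE /= !inordK.
by move=> /(congr1 val); rewrite /= !inordK.
Qed.

(** * Lifting partitions from the central quotient *)

Lemma cosetpre_center_cycle_abelian (gT : finGroupType) (G : {group gT})
    (q : coset_of 'Z(G)) :
  q \in G / 'Z(G) -> abelian (coset 'Z(G) @*^-1 <[q]>).
Proof.
move=> Qq; have sKG : coset 'Z(G) @*^-1 <[q]> \subset G.
  by rewrite (sub_cosetpre_quo _ (center_normal G)) cycle_subG.
apply: (@cyclic_factor_abelian _ 'Z(G)%G); last by rewrite cosetpreK cycle_cyclic.
rewrite subsetI sub_cosetpre /=.
by rewrite (subset_trans (subsetIr _ _)) // centS.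
Qed.

Lemma has_abelian_partition_cosetpre (gT : finGroupType) (n : nat)
    (G : {group gT}) (q : coset_of 'Z(G)) (S : 'I_n -> {set coset_of 'Z(G)}) :
    1 < n -> 1 < #|'Z(G)| -> q \in G / 'Z(G) ->
    (forall i, S i != set0) ->
    (forall i, exists2 r, r \in G / 'Z(G) & S i \subset <[r]>) ->
    (forall i, [disjoint <[q]> & S i]) ->
    (forall i j, i != j -> [disjoint S i & S j]) ->
    <[q]> :|: \bigcup_i S i = G / 'Z(G) ->
  has_abelian_partition n G (coset 'Z(G) @*^-1 <[q]>).
Proof.
move=> n_gt1 Z_gt1 Qq S0 Scyc disjqS disjS covS.
have disj_pre (C D : {set coset_of 'Z(G)}) :
    [disjoint C & D] -> [disjoint coset 'Z(G) @*^-1 C & coset 'Z(G) @*^-1 D].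
  by rewrite -!setI_eq0 -morphpreI => /eqP->; rewrite morphpre0.
split=> //.
- by rewrite (sub_cosetpre_quo _ (center_normal G)) cycle_subG.
- exact: cosetpre_center_cycle_abelian.
exists (fun i => coset 'Z(G) @*^-1 (S i)); split=> [i|i|i|i j ne_ij|].
- have [r Qr sSr] := Scyc i.
  exact: abelianS (morphpreS _ sSr) (cosetpre_center_cycle_abelian Qr).
(* The preimage of a nonempty piece contains a whole coset of ['Z(G)], hence at least two
   elements. *)
- have /set0Pn[c Sc] := S0 i; apply: leq_trans Z_gt1 _.
  have [x Nx def_c] := cosetP c; rewrite -(card_rcoset _ x) -cosetpre_set1 //.
  by rewrite -def_c subset_leq_card // morphpreS ?sub1set.
- exact: disj_pre.
- exact: disj_pre (disjS _ _ ne_ij).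
rewrite -[RHS](quotientGK (center_normal G)) -covS morphpreU; congr (_ :|: _).
by rewrite (big_morph _ (@morphpreU _ _ _ _) (@morphpre0 _ _ _ _)).
Qed.

(** For [n = 3] this serves quotients of order 4 with [q = 1] and of order 6 with [q] of order 3:
    three elements remain outside [<[q]>] each time. *)
Lemma has_abelian_partition_singletons (gT : finGroupType) (n : nat)
    (G : {group gT}) (q : coset_of 'Z(G)) :
    1 < n -> 1 < #|'Z(G)| -> q \in G / 'Z(G) ->
    #|G / 'Z(G) :\: <[q]>| = n ->
  has_abelian_partition n G (coset 'Z(G) @*^-1 <[q]>).
Proof.
move=> n_gt1 Z_gt1 Qq oD; set D := _ :\: _ in oD.
pose f i : coset_of 'Z(G) := enum_val (cast_ord (esym oD) i).
have Df i : f i \in D by apply: enum_valP.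
have f_inj : injective f by move=> i j /enum_val_inj/cast_ord_inj.
apply: (@has_abelian_partition_cosetpre _ _ _ _ (fun i => [set f i])) => // [i|i|i|i j|].
- by apply/set0Pn; exists (f i); rewrite inE.
- by exists (f i); rewrite ?sub1set ?cycle_id //; case/setDP: (Df i).
- by rewrite disjoint_sym disjoints1; case/setDP: (Df i).
- by rewrite disjoints1 inE (inj_eq f_inj).
apply/setP=> r; rewrite inE; have [q_r|q'r] /= := boolP (r \in <[q]>).
  by rewrite (subsetP _ _ q_r) ?cycle_subG.
apply/bigcupP/idP=> [[i _ /set1P->]|Qr]; first by case/setDP: (Df i).
have Dr : r \in D by rewrite inE q'r.
exists (cast_ord oD (enum_rank_in Dr r)) => //.
by rewrite inE /f cast_ordK enum_rankK_in.
Qed.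

(** The quotient is the union of four subgroups of order 3 with pairwise trivial intersection. One
    is [<[q]>]; the pieces are the non-identity elements of the other three. *)
Lemma has_abelian_partition_abelem9 (gT : finGroupType)
    (G : {group gT}) (q : coset_of 'Z(G)) :
    1 < #|'Z(G)| -> 3.-abelem (G / 'Z(G)) -> #|G / 'Z(G)| = 9 ->
    q \in G / 'Z(G) -> #[q] = 3 ->
  has_abelian_partition 3 G (coset 'Z(G) @*^-1 <[q]>).
Proof.
move=> Z_gt1 abelQ oQ Qq oq; have abQ := abelem_abelian abelQ.
have sqQ : <[q]> \subset G / 'Z(G) by rewrite cycle_subG.
have /subsetPn[y Qy q'y] : ~~ (G / 'Z(G) \subset <[q]>).
  by apply/negP=> /subset_leq_card; rewrite oQ -orderE oq.
have oy : #[y] = 3 by rewrite (abelem_order_p abelQ) //; apply: contraNneq q'y => ->.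
have mulQ : <[q]> * <[y]> = G / 'Z(G).
  apply/eqP; rewrite eqEcard mul_subG ?cycle_subG //= oQ TI_cardMg -?orderE ?oq ?oy //.
  by rewrite setIC prime_TIg -?orderE ?oy ?cycle_subG.
(* The coset of [<[q]>] through [y] contains exactly one generator of each subgroup of order 3 other
   than [<[q]>]. *)
pose g (i : 'I_3) := y * q ^+ i.
have Qg i : g i \in G / 'Z(G) by rewrite groupM ?groupX.
have q'g i : g i \notin <[q]> by rewrite groupMr ?mem_cycle.
have g_inj : injective g.
  move=> i j /mulgI/eqP; rewrite eq_expg_mod_order oq !modn_small // => /eqP.
  exact: val_inj.
(* Equality would put [y ^+ 2] in [<[q]>], and with it its inverse, which is [y]. *)
have neq_gV i j : g i != (g j)^-1.
  apply: contraNneq q'y => gV;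
  have cgy : commute (q ^+ i) y by apply: (centsP abQ); rewrite ?groupX.
  have gg : g i * g j = y ^+ 2 * q ^+ (i + j).
    by rewrite /g mulgA -(mulgA y) cgy !mulgA -mulgA expgD.
  have : y ^+ 2 \in <[q]>.
    by rewrite -(groupMr _ (mem_cycle q (i + j))) -gg gV mulVg group1.
  rewrite -groupV; suff -> : (y ^+ 2)^-1 = y by [].
  by apply/eqP; rewrite eq_invg_mul -expgSr -oy expg_order.
have gP w : w \in <[q]> -> exists i, y * w = g i.
  by case/cyclePmin=> m; rewrite oq => lt_m3 ->; exists (Ordinal lt_m3).
pose S i := [set g i; (g i)^-1].
apply: (@has_abelian_partition_cosetpre _ _ _ _ S) => // [i|i|i|i j|].
- by apply/set0Pn; exists (g i); rewrite !inE eqxx.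
- exists (g i) => //; apply/subsetP=> t /set2P[]->; rewrite ?groupV ?cycle_id //.
- rewrite disjoint_sym disjoints_subset; apply/subsetP=> t.
  by case/set2P=> ->; rewrite inE ?groupV.
- move=> ne_ij; rewrite disjoints_subset; apply/subsetP=> t.
  by case/set2P=> ->; rewrite !inE ?(inj_eq invg_inj) ?(inj_eq g_inj)
       ?[_^-1 == g _]eq_sym negb_or ne_ij neq_gV.
apply/setP=> t; apply/setUP/idP=> [[|/bigcupP[i _ /set2P[]->]]|].
- exact: (subsetP sqQ).
- exact: Qg.
- by rewrite groupV.
rewrite -mulQ => /mulsgP[u v q_u /cyclePmin[m]]; rewrite oy => lt_m3 -> ->{t v}.
have cuy : commute u y by apply: (centsP abQ) => //; apply: (subsetP sqQ).
(* For [m = 0] the element lies in [<[q]>], for [m = 1] it is some [g i], and for [m = 2] it is the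
   inverse of [y * u^-1], since [y ^+ 2 = y^-1]. *)
case: m lt_m3 => [|[|[|//]]] _; first by left; rewrite mulg1.
  right; have [i gi] := gP u q_u; apply/bigcupP; exists i => //.
  by rewrite !inE cuy gi eqxx.
right; have [i gi] := gP u^-1 (groupVr q_u); apply/bigcupP; exists i => //.
rewrite !inE -gi invMg invgK -[y^-1]mulg1 -[X in y^-1 * X](expg_order y) oy.
by rewrite expgS mulKg eqxx orbT.
Qed.

(** Brings the subgroup of condition (2) into the form used by the lifting lemmas. *)
Lemma cosetpre_cycle_coset (gT : finGroupType) (H : {group gT}) (x : gT) :
  x \in 'N(H) -> coset H @*^-1 <[coset H x]> = <<x |: H>>.
Proof.
move=> Nx; rewrite -quotient_cycle // quotientK ?cycle_subG //.
by rewrite -norm_joinEr ?cycle_subG // joing_idr /joing setUC.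
Qed.

(** * Order of the central quotient, and the equivalence *)

Lemma cover_by_four_abelian (gT : finGroupType) (I : finType) (G : {group gT})
    (H : I -> {group gT}) :
    ~~ abelian G -> #|I| = 4 -> (forall i, H i \subset G) ->
    (forall i, abelian (H i)) -> G \subset \bigcup_i H i ->
  [\/ #|G / 'Z(G)| = 4, #|G / 'Z(G)| = 6 | #|G / 'Z(G)| = 9].
Proof.
move=> nabG oI sHG abH covG.
have [|i] := cover_small_index _ sHG covG; rewrite oI // => lt_iH4.
have iH_neq1 : #|G : H i| != 1%N.
  by apply: contraNneq nabG => /eqP; rewrite indexg_eq1 => /abelianS->.
have prG : prime #|G : H i|.
  by move: lt_iH4 iH_neq1 (indexg_gt0 G (H i)); case: #|_ : _| => [|[|[|[|]]]].
have lt_HZ := index_center_prime_index nabG sHG abH covG prG; rewrite oI in lt_HZ.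
have sZH := center_sub_prime_index nabG (sHG i) (abH i) prG.
have ncQ : ~~ cyclic (G / 'Z(G)).
  by apply: contra nabG; apply: cyclic_factor_abelian.
have oQ : #|G / 'Z(G)| = (#|G : H i| * #|H i : 'Z(G)|)%N.
  by rewrite card_quotient ?normal_norm ?center_normal // Lagrange_index.
have npQ : ~~ prime #|G / 'Z(G)| by apply: contra ncQ; apply: prime_cyclic.
(* The first index is 2 or 3 and the second 1, 2 or 3. The value 1 would make the quotient of prime
   order, so the products left are 4, 6 and 9. *)
move: lt_iH4 iH_neq1 lt_HZ (indexg_gt0 G (H i)) (indexg_gt0 (H i) 'Z(G)) npQ.
rewrite oQ; case: #|G : H i| => [|[|[|[|]]]] //;
  case: #|H i : 'Z(G)| => [|[|[|[|]]]] // *;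
  by [apply: Or31 | apply: Or32 | apply: Or33].
Qed.

Theorem theorem3p2 (gT : finGroupType) (G : {group gT})
    (nonabelianG : ~~ abelian G) :
  ((exists A : {group gT}, has_abelian_partition 3 G A) <->
   (exists A : {group gT}, central_quotient_condition G A)) /\
  (forall A : {group gT},
     central_quotient_condition G A -> has_abelian_partition 3 G A).
Proof.
have sufficient (A : {group gT}) :
    central_quotient_condition G A -> has_abelian_partition 3 G A.
  case=> Z_gt1 [[isoQ defA] | [isoQ [x [Gx _ ox defA]]]].
    have /andP[_ /eqP oQ] : 2.-abelem (G / 'Z(G)) && (#|G / 'Z(G)| == 2 ^ 2)%N.
      by rewrite -isog_Zp2.
    have -> : A = (coset 'Z(G) @*^-1 <[1]>)%G.
      by apply: group_inj; rewrite /= cycle1 cosetpre1.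
    apply: has_abelian_partition_singletons; rewrite ?group1 // cycle1.
    by rewrite cardsD (setIidPr (sub1G _)) oQ cards1.
  have Nx : x \in 'N('Z(G)) by apply: subsetP Gx; rewrite normal_norm ?center_normal.
  have Qx : coset 'Z(G) x \in G / 'Z(G) by apply: mem_quotient.
  have -> : A = (coset 'Z(G) @*^-1 <[coset 'Z(G) x]>)%G.
    by apply: group_inj; rewrite defA /= cosetpre_cycle_coset.
  case: isoQ => [isoQ | /card_isog].
    have /andP[abelQ /eqP oQ] : 3.-abelem (G / 'Z(G)) && (#|G / 'Z(G)| == 3 ^ 2)%N.
      by rewrite -isog_Zp2.
    exact: has_abelian_partition_abelem9.
  rewrite cardsT card_Sn => oQ; apply: has_abelian_partition_singletons => //.
  by rewrite cardsD (setIidPr _) ?cycle_subG // oQ -orderE ox.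
split=> //; split=> [[A [_ sAG abA [B [abB B_gt1 dAB dB covG]]]] | [A condA]];
  last by exists A; apply: sufficient.
(* A commuting set generates an abelian subgroup; the four subgroups still cover [G], though they
   are no longer disjoint. *)
pose H (o : option 'I_3) := if o is Some i then <<B i>>%G else A.
have oG : 6 < #|G|.
  rewrite -covG cardsU disjoint_setI0 ?cards0 ?subn0; last first.
    by apply: bigcup_disjoint => i _.
  rewrite -[#|\bigcup_(i < 3) B i|]sum1_card partition_disjoint_bigcup //.
  apply: (@leq_add 1 6); first exact: cardG_gt0.
  apply: (@leq_trans (\sum_(i < 3) 2)); first by rewrite sum_nat_const card_ord.
  by apply: leq_sum => i _; rewrite sum1_card.
have ncQ : ~~ cyclic (G / 'Z(G)).
  by apply: contra nonabelianG; apply: cyclic_factor_abelian.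
have oQ : [\/ #|G / 'Z(G)| = 4, #|G / 'Z(G)| = 6 | #|G / 'Z(G)| = 9].
  apply: (@cover_by_four_abelian _ _ _ H) => // [|[i|]|[i|]|] //.
  - by rewrite card_option card_ord.
  - by rewrite /= gen_subG -covG subsetU // (bigcup_sup i) ?orbT.
  - by rewrite /= abelian_gen.
  rewrite -covG subUset (bigcup_sup None) //=.
  by apply/bigcupsP=> i _; rewrite (bigcup_max (Some i)) //= subset_gen.
(* With trivial center [G] itself has order 4, 6 or 9: squares of primes force [G] to be abelian,
   and 6 contradicts [oG]. *)
have Z_gt1 : 1 < #|'Z(G)|.
  rewrite cardG_gt1; apply: contraNneq nonabelianG => Z1.
  have oQG : #|G / 'Z(G)| = #|G|.
    by rewrite Z1 (card_isog (quotient1_isog G)).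
  case: oQ; rewrite oQG => oG'.
  - exact: (@card_p2group_abelian _ 2).
  - by rewrite oG' in oG.
  - exact: (@card_p2group_abelian _ 3).
have order3 : 3 %| #|G / 'Z(G)| ->
    exists x, [/\ x \in G, x \notin 'Z(G) & #[coset 'Z(G) x] = 3].
  case/Cauchy=> // q /morphimP[x _ Gx ->] ox; exists x; split=> //.
  by apply/negP=> Zx; move: ox; rewrite /= coset_id // order1.
case: oQ => oQ.
(* The witness is built from the quotient in each case, not taken from the given partition. *)
- by exists 'Z(G)%G; split=> //; left; rewrite isog_Zp2 // oQ p2group_abelem.
- have [|x [Gx Z'x ox]] := order3; first by rewrite oQ.
  exists <<x |: 'Z(G)>>%G; split=> //; right; split; last by exists x.
  by right; apply: isog_S3.
- have [|x [Gx Z'x ox]] := order3; first by rewrite oQ.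
  exists <<x |: 'Z(G)>>%G; split=> //; right; split; last by exists x.
  by left; rewrite isog_Zp2 // oQ p2group_abelem.
Qed.
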